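(* Let $\Gamma$ be an abelian group and let $R$ be a $\Gamma$-graded gr-prime ring of characteristic different from $2$. Suppose $d_1$ and $d_2$ are nonzero homogeneous derivations of $R$ such that $d_1(d_2(x))\in Z(R)$ for all $x\in R$. Then $R$ is a commutative graded ring.
   Context: A ring $R$ is $\Gamma$-graded if $R=\bigoplus_{\tau\in\Gamma}R_\tau$ as additive groups with $R_\tau R_\sigma\subseteq R_{\tau\sigma}$; the set of homogeneous elements is $\mathcal{H}(R)=\bigcup_{\tau}R_\tau$. $R$ is gr-prime if for $a,b\in\mathcal{H}(R)$, $aRb=0$ implies $a=0$ or $b=0$. $Z(R)$ is the center of $R$. A homogeneous derivation is an additive map $d:R\to R$ with $d(xy)=d(x)y+xd(y)$ for all $x,y\in R$ and $d(\mathcal{H}(R))\subseteq\mathcal{H}(R)$. *)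

(* Defs.v *)
From HB Require Import structures.
From mathcomp Require Import all_boot all_algebra.

Set Implicit Arguments.
Unset Strict Implicit.
Unset Printing Implicit Defensive.

Import GRing.Theory.
Local Open Scope ring_scope.

(* Associative rings, not assumed unital or commutative.  [pzRingType] requires
   a 1, so the structure joins [zmodType] with the multiplicative
   [semigroupType]; its product is written [(x * y)%g]. *)
HB.mixin Record Semigroup_Zmodule_isRng R of Semigroup R & GRing.Zmodule R := {
  rng_mulDl : forall x y z : R, ((x + y)%R * z)%g = (x * z)%g + (y * z)%g;
  rng_mulDr : forall x y z : R, (x * (y + z)%R)%g = (x * y)%g + (x * z)%g
}.

#[short(type="rngType")]
HB.structure Definition Rng :=
  { R of Semigroup_Zmodule_isRng R & Semigroup R & GRing.Zmodule R }.

(* Unital rings are instances, through the alias [rng_of_ring]. *)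
Definition rng_of_ring (R : pzRingType) : Type := R.

HB.instance Definition _ (R : pzRingType) :=
  GRing.Zmodule.on (rng_of_ring R).
HB.instance Definition _ (R : pzRingType) :=
  hasMul.Build (rng_of_ring R) (@GRing.mul R).
HB.instance Definition _ (R : pzRingType) :=
  Magma_isSemigroup.Build (rng_of_ring R) (@mulrA R).
HB.instance Definition _ (R : pzRingType) :=
  Semigroup_Zmodule_isRng.Build (rng_of_ring R) (@mulrDl R) (@mulrDr R).

(* The characteristic is the generator n >= 0 of {m | m R = 0}; without a 1 it
   cannot be read off from the multiples of 1. *)
Definition has_characteristic (R : rngType) (n : nat) : Prop :=
  forall m : nat, (forall x : R, x *+ m = 0) <-> (n %| m)%N.

Definition in_center (R : rngType) (z : R) : Prop :=
  forall x : R, (z * x)%g = (x * z)%g.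

(* The abelian group Gamma is written additively.  [grading_span] and
   [grading_indep] say that R is the internal direct sum of the [C t]. *)
Record is_grading (Gamma : zmodType) (R : rngType) (C : Gamma -> R -> Prop) :
    Prop := {
  grading_zero : forall t, C t 0;
  grading_sub : forall t x y, C t x -> C t y -> C t (x - y);
  grading_span : forall x : R, exists (s : seq Gamma) (f : Gamma -> R),
    [/\ uniq s, forall t, C t (f t) & x = \sum_(t <- s) f t];
  grading_indep : forall (s : seq Gamma) (f : Gamma -> R),
    uniq s -> (forall t, C t (f t)) -> \sum_(t <- s) f t = 0 ->
    forall t, t \in s -> f t = 0;
  grading_mul : forall s t x y, C s x -> C t y -> C (s + t) (x * y)%g
}.

Definition homogeneous (Gamma : zmodType) (R : rngType)
    (C : Gamma -> R -> Prop) (x : R) : Prop :=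
  exists t : Gamma, C t x.

Definition gr_prime (Gamma : zmodType) (R : rngType)
    (C : Gamma -> R -> Prop) : Prop :=
  forall a b : R, homogeneous C a -> homogeneous C b ->
    (forall r : R, (a * r * b)%g = 0) -> a = 0 \/ b = 0.

(* The degree of [d x] may depend on [x]: [d] need not be of a fixed degree. *)
Record homogeneous_derivation (Gamma : zmodType) (R : rngType)
    (C : Gamma -> R -> Prop) (d : {additive R -> R}) : Prop := {
  hderiv_leibniz : forall x y : R, d (x * y)%g = (d x * y)%g + (x * d y)%g;
  hderiv_homogeneous : forall x : R, homogeneous C x -> homogeneous C (d x)
}.

(* Main.v *)
Require Import Defs.
From mathcomp Require Import all_boot all_algebra.
Import GRing.Theory.
Local Open Scope ring_scope.

(** Write [c = d1 \o d2] and suppose that two homogeneous elements do not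
commute; the argument refutes this in three moves, after which additivity in
each variable gives commutativity.

Gr-primeness supplies the cancellation: [x R b = 0] with [b] homogeneous and
nonzero forces [x = 0] for every [x], homogeneous or not
([gr_prime_annih]), so nonzero homogeneous central elements are regular, and a
ring whose characteristic is not 2 has no 2-torsion at all
([gr_prime_torsion2_free]).

First, [d1] kills the homogeneous center ([deriv_center_eq0]). For [z] central,
[c (z x) - z c x] is central and equals [c z * x + E x] for the derivation
[E = d2 z * d1 + d1 z * d2]. Such a derivation satisfies [[E x, x] = 0], as in
Posner's theorem on centralizing derivations, so noncommutativity gives
[E = 0]. Evaluating [E] at [z] yields [d1 z * d2 z = 0], and regularity
together with [d2 <> 0] then leaves only [d1 z = 0].

Second, [c] kills homogeneous elements ([deriv_comp_eq0]). If [z = c u] is not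
zero, put [v = d2 u] and [p = d2 v]. Since [d1 (c (x y)) = 0], the choices
[(x, y) = (v, v)] and [(v, u)] of this identity give [d1 p = 0] and
[p * d1 (d1 u) = - 2 z^2], so [p <> 0]. Then [c (v v) = 2 p z] shows that [p] is
central, and [c (v y)] central shows that [[p * d1 y + z * d2 y, v] = 0] for
all [y]. Putting [y v] for [y] gives [2 p z [y, v] = 0]: [v] is central although
[d1 v = z] is not zero, against the first move.

Third, [c] cannot vanish identically ([deriv_comp_neq0]): otherwise
[d2 (d2 x) * d1 y = 0] for all [x] and [y], hence [d2 \o d2 = 0], hence
[2 * d2 x * d2 y = 0], hence [d2 = 0]. *)

(** * Products in rings without unit *)

Section Rngs.

Set Implicit Arguments.
Unset Strict Implicit.
Local Notation "x * y" := (x * y)%g : ring_scope.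

Context {R : rngType}.
Implicit Types (x y z w r : R) (d E : R -> R).

Lemma rng_mul0r x : 0 * x = 0.
Proof. by apply: (addIr (0 * x)); rewrite -rng_mulDl !add0r. Qed.

Lemma rng_mulr0 x : x * 0 = 0.
Proof. by apply: (addIr (x * 0)); rewrite -rng_mulDr !add0r. Qed.

Lemma rng_mulNr x y : (- x) * y = - (x * y).
Proof. by apply: (addIr (x * y)); rewrite -rng_mulDl !addNr rng_mul0r. Qed.

Lemma rng_mulrN x y : x * (- y) = - (x * y).
Proof. by apply: (addIr (x * y)); rewrite -rng_mulDr !addNr rng_mulr0. Qed.

Lemma rng_mulBl x y z : (x - y) * z = x * z - y * z.
Proof. by rewrite rng_mulDl rng_mulNr. Qed.

Lemma rng_mulBr x y z : x * (y - z) = x * y - x * z.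
Proof. by rewrite rng_mulDr rng_mulrN. Qed.

Lemma rng_mul_suml (I : Type) (s : seq I) (F : I -> R) x :
  (\sum_(i <- s) F i) * x = \sum_(i <- s) (F i * x).
Proof.
by apply: (big_morph (fun y => y * x) (fun y z => rng_mulDl y z x) (rng_mul0r x)).
Qed.

(** * Commutators and central elements *)

Definition lie x y : R := x * y - y * x.

Lemma lie_eq0 x y : lie x y = 0 -> x * y = y * x.
Proof. exact: subr0_eq. Qed.

Lemma liexx x : lie x x = 0.
Proof. exact: subrr. Qed.

Lemma lieDl x y z : lie (x + y) z = lie x z + lie y z.
Proof. by rewrite /lie rng_mulDl rng_mulDr opprD addrACA. Qed.

Lemma lieMl x y z : lie (x * y) z = x * lie y z + lie x z * y.
Proof. by rewrite /lie rng_mulBr rng_mulBl !mulgA addrA subrK. Qed.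

Lemma lie_center x y : in_center x -> lie x y = 0.
Proof. by rewrite /lie => ->; rewrite subrr. Qed.

Lemma lie0_center x : (forall y, lie x y = 0) -> in_center x.
Proof. by move=> h y; apply: lie_eq0. Qed.

Lemma in_centerB x y : in_center x -> in_center y -> in_center (x - y).
Proof. by move=> hx hy w; rewrite rng_mulBl rng_mulBr hx hy. Qed.

Lemma in_centerM x y : in_center x -> in_center y -> in_center (x * y).
Proof. by move=> hx hy w; rewrite -mulgA hy mulgA (hx w) mulgA. Qed.

(** * Derivations *)

Definition leibniz d := forall x y, d (x * y) = d x * y + x * d y.

Lemma leibniz_center (d : {additive R -> R}) z :
  leibniz d -> in_center z -> in_center (d z).
Proof.
move=> hd hz x; apply: (addIr (z * d x)).
by rewrite -hd hz hd (hz (d x)) addrC.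
Qed.

Lemma leibniz_comb d1 d2 a b : leibniz d1 -> leibniz d2 ->
  in_center a -> in_center b -> leibniz (fun x => a * d1 x + b * d2 x).
Proof.
move=> h1 h2 ha hb x y.
rewrite h1 h2 !rng_mulDr rng_mulDl addrACA !mulgA.
by rewrite (ha x) (hb x).
Qed.

(** In [a * d (r * y) = a * d r * y + a * r * d y], the left side and the term
[a * d r * y] are [0]. *)
Lemma leibniz_annih d a : leibniz d -> (forall y, a * d y = 0) ->
  forall r y, a * r * d y = 0.
Proof.
move=> hd h r y; move: (h (r * y)).
by rewrite hd rng_mulDr !mulgA h rng_mul0r add0r.
Qed.

Lemma comp_leibniz (d1 d2 : {additive R -> R}) x y : leibniz d1 -> leibniz d2 ->
  d1 (d2 (x * y)) =
    (d1 (d2 x) * y + d2 x * d1 y) + (d1 x * d2 y + x * d1 (d2 y)).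
Proof. by move=> h1 h2; rewrite h2 raddfD h1 h1. Qed.

(** Since [a * x + E x] is central, [lie (E u) y = - a * lie u y] for all [u].
Taking [u = x * w] and expanding both sides with the two Leibniz rules, the
terms in [a] cancel. *)
Lemma centralizing_leibniz E a : leibniz E -> in_center a ->
  (forall x, in_center (a * x + E x)) ->
  forall x w y, E x * lie w y + lie x y * E w = 0.
Proof.
move=> hE ha h x w y.
have lieE u : lie (E u) y = - (a * lie u y).
  apply: (addrI (a * lie u y)); rewrite subrr.
  by rewrite -(lie_center y (h u)) lieDl lieMl (lie_center y ha) rng_mul0r addr0.
move: (lieE (x * w)); rewrite hE lieDl !lieMl !lieE.
move: (lie w y) (lie x y) => l m; rewrite !rng_mulrN rng_mulNr rng_mulDr !mulgA.
rewrite (ha x) opprD (addrC (- _) (m * _)) addrACA (addrC (- (a * m * w))) => e.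
by apply: (addIr (- (x * a * l) - a * m * w)); rewrite add0r.
Qed.

End Rngs.

(** * Gradings *)

Section GradedRngs.

Set Implicit Arguments.
Unset Strict Implicit.
Local Notation "x * y" := (x * y)%g : ring_scope.

Context {Gamma : zmodType} {R : rngType} {C : Gamma -> R -> Prop}.
Hypothesis hC : is_grading C.
Implicit Types (x y z w r : R).

Lemma homogeneousM x y :
  homogeneous C x -> homogeneous C y -> homogeneous C (x * y).
Proof. by move=> [s hx] [t hy]; exists (s + t); apply: grading_mul. Qed.

Lemma gradingD t x y : C t x -> C t y -> C t (x + y).
Proof.
move=> hx hy; rewrite -[y]opprK; apply: (grading_sub hC) => //.
by rewrite -[- y]add0r; apply: (grading_sub hC) => //; apply: grading_zero.
Qed.

Lemma homogeneous_double x : homogeneous C x -> homogeneous C (x + x).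
Proof. by move=> [t hx]; exists t; apply: gradingD. Qed.

(** Commutativity of [Gamma] puts [x * y] and [y * x] in the same component. *)
Lemma homogeneous_lie x y :
  homogeneous C x -> homogeneous C y -> homogeneous C (lie x y).
Proof.
move=> [s hx] [t hy]; exists (s + t).
apply: (grading_sub hC); first exact: grading_mul.
by rewrite addrC; apply: grading_mul.
Qed.

Lemma homogeneous_ind (P : R -> Prop) : P 0 ->
  (forall x y, P x -> P y -> P (x + y)) ->
  (forall x, homogeneous C x -> P x) -> forall x, P x.
Proof.
move=> P0 PD Ph x; have [s [f [_ hf ->]]] := grading_span hC x.
by apply: big_ind => // t _; apply: Ph; exists t.
Qed.

(** Independence for summands that sit in the shifted degrees [t + g]; it serves
to compare the components of a product with a homogeneous element. *)
Lemma grading_shift_indep (s : seq Gamma) (f : Gamma -> R) g : uniq s ->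
  (forall t, C (t + g) (f t)) -> \sum_(t <- s) f t = 0 ->
  forall t, t \in s -> f t = 0.
Proof.
move=> us hf f0 t ts.
rewrite -[t](addrK g).
have us' : uniq [seq u + g | u <- s] by rewrite map_inj_uniq //; apply: addIr.
apply: (grading_indep hC (f := fun u => f (u - g)) us').
- by move=> u; rewrite -{1}[u](subrK g).
- by rewrite big_map -[RHS]f0; apply: eq_bigr => u _; rewrite addrK.
- exact: map_f.
Qed.

Lemma exists_homogeneous_neq0 (d : {additive R -> R}) :
  (exists x, d x <> 0) -> exists2 x, homogeneous C x & d x <> 0.
Proof.
case=> x dx0; have [s [f [_ hf def_x]]] := grading_span hC x.
have /hasP[t _ /eqP ft0] : has (fun t => d (f t) != 0) s.
  apply/negPn/negP => /hasPn h; apply: dx0.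
  rewrite def_x raddf_sum big_seq big1 // => t /h.
  by rewrite negbK => /eqP.
by exists (f t) => //; exists t.
Qed.

(** * Cancellation in gr-prime rings *)

Hypothesis hprime : gr_prime C.

(** For [r] homogeneous, the components of [x] multiplied by [r] and [b] lie in
distinct degrees, so each component of [x] satisfies the hypothesis of
gr-primeness. Allowing [x] to be arbitrary matters below, where it is a value
of a derivation that need not be homogeneous. *)
Lemma gr_prime_annih x b : homogeneous C b -> b <> 0 ->
  (forall r, x * r * b = 0) -> x = 0.
Proof.
move=> hb b0 h; have [s [f [us hf def_x]]] := grading_span hC x.
have [g hg] := hb.
suff f0 t : t \in s -> f t = 0 by rewrite def_x big_seq big1.
move=> ts; case: (hprime (a := f t) (b := b)) => //; first by exists t.
apply: homogeneous_ind; first by rewrite rng_mulr0 rng_mul0r.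
  by move=> y z hy hz; rewrite rng_mulDr rng_mulDl hy hz addr0.
move=> r [u hr].
apply: (@grading_shift_indep s (fun t => f t * r * b) (u + g)) => //.
  by move=> v; rewrite addrA; do 2!apply: (grading_mul hC) => //.
by rewrite -!rng_mul_suml -def_x h.
Qed.

Lemma center_regular z x : homogeneous C z -> in_center z -> z <> 0 ->
  z * x = 0 -> x = 0.
Proof.
move=> hz cz z0 zx; apply: gr_prime_annih hz z0 _ => r.
by rewrite -cz mulgA zx rng_mul0r.
Qed.

Lemma gr_prime_deriv_annih d a : leibniz d ->
  (exists2 y, homogeneous C (d y) & d y <> 0) ->
  (forall y, a * d y = 0) -> a = 0.
Proof.
move=> hd [y hdy dy0] h; apply: gr_prime_annih hdy dy0 _ => r.
exact: leibniz_annih.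
Qed.

(** If [x + x = 0] with [x <> 0] then [x * r * (y + y) = (x + x) * r * y = 0], so
[y + y = 0] for homogeneous [y], hence for all [y]; as [x <> 0], no odd number
annihilates the ring, so its characteristic is 2. *)
Lemma gr_prime_torsion2_free : ~ has_characteristic R 2 ->
  forall x, x + x = 0 -> x = 0.
Proof.
move=> hchar x xx0; apply/eqP/negPn/negP => /eqP x0.
have double0 : forall y : R, y + y = 0.
  apply: homogeneous_ind; first exact: addr0.
    by move=> y z hy hz; rewrite addrACA hy hz addr0.
  move=> y hy; apply/eqP/negPn/negP => /eqP yy0.
  apply: x0; apply: gr_prime_annih (homogeneous_double hy) yy0 _ => r.
  by rewrite rng_mulDr -rng_mulDl -rng_mulDl xx0 !rng_mul0r.
have mul2n0 m (y : R) : y *+ m.*2 = 0.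
  by rewrite -mul2n mulrnA mulr2n double0 mul0rn.
apply: hchar => m; rewrite dvdn2; split=> [h | /negbTE odd_m y].
  apply/negP => odd_m; apply: x0.
  by rewrite -(h x) -[m]odd_double_half odd_m mulrnDr mul2n0 addr0.
by rewrite -[m]odd_double_half odd_m mul2n0.
Qed.

Hypothesis torsion2_free : forall x, x + x = 0 -> x = 0.

(** * Two derivations with central composition *)

Section Composition.

Variables d1 d2 : {additive R -> R}.
Hypotheses (hd1 : homogeneous_derivation C d1)
  (hd2 : homogeneous_derivation C d2).
Hypotheses (d1_neq0 : exists x : R, d1 x <> 0)
  (d2_neq0 : exists x : R, d2 x <> 0).

Let L1 : leibniz d1 := hderiv_leibniz hd1.
Let L2 : leibniz d2 := hderiv_leibniz hd2.

(** The composition rule reduces to [d2 x * d1 y + d1 x * d2 y = 0], and putting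
[d2 x] for [x] kills its second term. *)
Lemma deriv_comp_neq0 : ~ (forall x, d1 (d2 x) = 0).
Proof.
have w1 : exists2 y, homogeneous C (d1 y) & d1 y <> 0.
  have [y hy y0] := exists_homogeneous_neq0 d1_neq0.
  by exists y => //; apply: (hderiv_homogeneous hd1).
have w2 : exists2 y, homogeneous C (d2 y) & d2 y <> 0.
  have [y hy y0] := exists_homogeneous_neq0 d2_neq0.
  by exists y => //; apply: (hderiv_homogeneous hd2).
move=> c0.
have dd x : d2 (d2 x) = 0.
  apply: (gr_prime_deriv_annih L1 w1) => y.
  by have := comp_leibniz (d2 x) y L1 L2;
     rewrite !c0 rng_mul0r rng_mulr0 rng_mul0r add0r !addr0.
have [x dx0] := d2_neq0; apply: dx0; apply: (gr_prime_deriv_annih L2 w2) => y.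
apply: torsion2_free.
by have := comp_leibniz x y L2 L2; rewrite !dd rng_mul0r rng_mulr0 add0r addr0.
Qed.

Hypothesis hcenter : forall x, in_center (d1 (d2 x)).

(** The derivation [E] below comes from comparing [d1 (d2 (z * x))] with
[z * d1 (d2 x)]; it vanishes because [a] and [b] do not commute, and [E z] is
twice [d1 z * d2 z]. [E] mixes two derivations of possibly different degrees,
so its values need not be homogeneous. *)
Lemma deriv_center_eq0 a b z : homogeneous C a -> homogeneous C b ->
  a * b <> b * a -> homogeneous C z -> in_center z -> d1 z = 0.
Proof.
move=> ha hb ab hz cz.
pose E x := d2 z * d1 x + d1 z * d2 x.
have c1 : in_center (d1 z) by apply: leibniz_center.
have c2 : in_center (d2 z) by apply: leibniz_center.
have LE : leibniz E by apply: leibniz_comb.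
have cE x : in_center (d1 (d2 z) * x + E x).
  have -> : d1 (d2 z) * x + E x = d1 (d2 (z * x)) - z * d1 (d2 x).
    by rewrite comp_leibniz // !addrA addrK.
  by apply: in_centerB => //; apply: in_centerM.
have EE := centralizing_leibniz LE (hcenter z) cE.
have lab0 : lie a b <> 0 by move=> /lie_eq0.
have lba0 : lie b a <> 0 by move=> /lie_eq0/esym.
have hab := homogeneous_lie ha hb; have hba := homogeneous_lie hb ha.
(* [EE] at [x = y = a] and [w = r * b]: the term in [lie a a] drops out. *)
have Ea0 : E a = 0.
  apply: gr_prime_annih hba lba0 _ => r.
  have := EE a (r * b) a; rewrite liexx rng_mul0r addr0 lieMl rng_mulDr !mulgA.
  have := EE a r a; rewrite liexx rng_mul0r addr0 => ->.
  by rewrite rng_mul0r addr0.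
(* As [E a = 0], [EE] at [w = a], [y = b] says that [E] annihilates [lie a b]. *)
have E0 x : E x = 0.
  apply: gr_prime_annih hab lab0 _ => r.
  have := EE (x * r) a b; rewrite Ea0 rng_mulr0 addr0 LE rng_mulDl.
  have := EE r a b; rewrite Ea0 rng_mulr0 addr0 -(mulgA x) => ->.
  by rewrite rng_mulr0 addr0.
have h12 : d1 z * d2 z = 0.
  by apply: torsion2_free; rewrite -[RHS](E0 z) /E (c2 (d1 z)).
apply/eqP/negPn/negP => /eqP z0.
have d2z : d2 z = 0.
  by apply: center_regular h12 => //; apply: (hderiv_homogeneous hd1).
have [y d2y] := d2_neq0; apply: d2y.
apply: (@center_regular (d1 z)) => //; first exact: (hderiv_homogeneous hd1).
by rewrite -[RHS](E0 y) /E d2z rng_mul0r add0r.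
Qed.

(** A nonzero value [z = d1 (d2 u)] would make [v = d2 u] central, by way of
[p = d2 v]; but [d1 v = z], while [d1] vanishes on homogeneous central elements. *)
Lemma deriv_comp_eq0 u : homogeneous C u ->
  (forall z, homogeneous C z -> in_center z -> d1 z = 0) -> d1 (d2 u) = 0.
Proof.
move=> hu d1Z; apply/eqP/negPn/negP => /eqP z0.
have H1 := hderiv_homogeneous hd1; have H2 := hderiv_homogeneous hd2.
have ddd x : homogeneous C x -> d1 (d1 (d2 x)) = 0.
  by move=> hx; apply: d1Z => //; apply/H1/H2.
(* The expansion of [d1 (d1 (d2 (x * y))) = 0]. *)
have J x y : homogeneous C x -> homogeneous C y ->
    (d1 (d2 x) * d1 y + (d1 (d2 x) * d1 y + d2 x * d1 (d1 y))) +
    ((d1 (d1 x) * d2 y + d1 x * d1 (d2 y)) + d1 x * d1 (d2 y)) = 0.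
  move=> hx hy; rewrite -[RHS](ddd (x * y)); last exact: homogeneousM.
  rewrite comp_leibniz // !raddfD /= !L1 !ddd //.
  by rewrite rng_mul0r rng_mulr0 add0r addr0.
set v := d2 u in z0 *; set z := d1 v in z0 *; set p := d2 v.
have hv : homogeneous C v by apply: H2.
have hz : homogeneous C z by apply: H1.
have hp : homogeneous C p by apply: H2.
have cz : in_center z by apply: hcenter.
have zreg x : z * x = 0 -> x = 0 by apply: center_regular.
have dz0 : d1 z = 0 by apply: d1Z.
(* [J v v] reads [4 * z * d1 p = 0]. *)
have dp0 : d1 p = 0.
  apply/zreg/torsion2_free/torsion2_free.
  have := J v v hv hv; rewrite -/p -/z dz0 -(cz (d1 p)).
  by rewrite rng_mulr0 rng_mul0r addr0 add0r.
(* [J v u] reads [p * d1 (d1 u) + 2 * z * z = 0]. *)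
have p0 : p <> 0.
  move=> p0; have := J v u hv hu; rewrite -/v -/p -/z dz0 dp0 p0.
  by rewrite !rng_mul0r !add0r => /torsion2_free/zreg.
(* [d1 (d2 (v * v)) = 2 * z * p]. *)
have cp : in_center p.
  apply: lie0_center => y; apply/zreg/torsion2_free.
  have := hcenter (v * v); rewrite comp_leibniz // -/p -/z dp0.
  rewrite rng_mul0r rng_mulr0 add0r addr0 -(cz p) => /(lie_center y).
  by rewrite lieDl lieMl (lie_center y cz) rng_mul0r addr0.
pose F y := p * d1 y + z * d2 y.
have LF : leibniz F by apply: leibniz_comb.
(* [d1 (d2 (v * y)) = F y + v * d1 (d2 y)], and [v] commutes with the last term. *)
have lieF y : lie (F y) v = 0.
  have := hcenter (v * y); rewrite comp_leibniz // -/p -/z dp0 rng_mul0r add0r.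
  rewrite addrA => /(lie_center v); rewrite lieDl lieMl liexx rng_mul0r.
  by rewrite (lie_center v (hcenter y)) rng_mulr0 !addr0.
(* [lie (F (y * v)) v = lie y v * F v] with [F v = 2 * z * p]. *)
have cv : in_center v.
  move=> y; apply/esym/lie_eq0/(center_regular hp cp p0)/zreg/torsion2_free.
  have := lieF (y * v); rewrite LF lieDl !lieMl !lieF liexx.
  rewrite !rng_mulr0 rng_mul0r !add0r /F -/p -/z -(cz p) rng_mulDr.
  by rewrite -(in_centerM cz cp) -mulgA.
by apply: z0; apply: d1Z.
Qed.

End Composition.

End GradedRngs.

Theorem theorem4p5 (Gamma : zmodType) (R : rngType) (C : Gamma -> R -> Prop)
    (hC : is_grading C) (hprime : gr_prime C)
    (hchar : ~ has_characteristic R 2)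
    (d1 d2 : {additive R -> R})
    (hd1 : homogeneous_derivation C d1) (hd2 : homogeneous_derivation C d2)
    (d1_neq0 : exists x : R, d1 x <> 0) (d2_neq0 : exists x : R, d2 x <> 0)
    (hcenter : forall x : R, in_center (d1 (d2 x))) :
  forall x y : R, (x * y)%g = (y * x)%g.
Proof.
have tf := gr_prime_torsion2_free hC hprime hchar.
suff comm a b : homogeneous C a -> homogeneous C b -> (a * b)%g = (b * a)%g.
  apply: (homogeneous_ind hC); first by move=> y; rewrite rng_mul0r rng_mulr0.
    by move=> x x' hx hx' y; rewrite rng_mulDl rng_mulDr hx hx'.
  move=> x hx; apply: (homogeneous_ind hC); first by rewrite rng_mul0r rng_mulr0.
    by move=> y y' hy hy'; rewrite rng_mulDl rng_mulDr hy hy'.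
  by move=> y; apply: comm.
move=> ha hb; apply/eqP/negPn/negP => /eqP ab.
apply: (deriv_comp_neq0 hC hprime tf hd1 hd2 d1_neq0 d2_neq0).
apply: (homogeneous_ind hC); first by rewrite !raddf0.
  by move=> x y hx hy; rewrite !raddfD /= hx hy addr0.
move=> u hu; apply: (deriv_comp_eq0 hC hprime tf hd1 hd2 hcenter hu).
move=> z; apply: (deriv_center_eq0 hC hprime tf hd1 hd2 d2_neq0 hcenter ha hb ab).
Qed.
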